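(* Let $(Y,d)$ be a $(1,\kappa)$-quasi-geodesic metric space (for some $\kappa\ge 0$) satisfying Axiom $1'$ (with ambient space $(\overline{Y},\overline{d})$ and boundary $\partial Y=\overline{Y}\setminus Y$) and Axiom $4'$, and suppose that for every $\zeta\in\partial Y$ and $z_0\in Y$ the intersection of the closures of big horoballs $\bigcap_{r\in\mathbb{R}}\overline{F_{z_0}(\zeta,r)}^{\overline{d}}$ consists of a single point. If $S=\{f_t:Y\to Y\}_{t\ge 0}$ is a one-parameter continuous semigroup of nonexpansive mappings on $Y$ without bounded orbits, and there exists $t_0>0$ such that $f_{t_0}:Y\to Y$ is a compact mapping, then there exists $\xi\in\partial Y$ such that the semigroup $S$ converges uniformly on bounded sets of $Y$ to $\xi$, i.e. $\sup_{x\in C}\overline{d}(f_t(x),\xi)\to 0$ as $t\to\infty$ for every bounded set $C\subset Y$.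
   Context: Quasi-geodesic spaces: $(Y,d)$ is $(1,\kappa)$-quasi-geodesic if every pair of points of $Y$ can be connected by a curve $\gamma:[a,b]\to Y$ with $|t_1-t_2|-\kappa\le d(\gamma(t_1),\gamma(t_2))\le |t_1-t_2|+\kappa$ for all $t_1,t_2\in[a,b]$. Axiom $1'$: $(Y,d)$ is an open dense subset of a metric space $(\overline{Y},\overline{d})$ whose relative topology on $Y$ coincides with the metric topology of $d$; and for any $w\in Y$, if $\{x_n\}$ is a sequence in $Y$ converging (in $\overline{d}$) to $\xi\in\partial Y=\overline{Y}\setminus Y$, then $d(x_n,w)\to\infty$. Axiom $4'$: if $\{x_n\},\{y_n\}$ are sequences in $Y$ with $x_n\to\xi\in\partial Y$, $y_n\to\eta\in\partial Y$, and $d(x_n,y_n)\le c$ for all $n$ and some constant $c$, then $\xi=\eta$. Big horoball of center $\zeta\in\partial Y$, pole $z_0\in Y$ and radius $r\in\mathbb{R}$: $F_{z_0}(\zeta,r)=\{y\in Y:\liminf_{w\to\zeta}\,(d(y,w)-d(w,z_0))\le r\}$, where $w\in Y$ tends to $\zeta$ in $\overline{d}$. $\overline{A}^{\overline{d}}$ denotes closure in $(\overline{Y},\overline{d})$. A map $f:Y\to Y$ is nonexpansive if $d(f(x),f(y))\le d(x,y)$ for all $x,y\in Y$; it is compact if $\overline{f(Y)}^{\overline{d}}$ is compact in $(\overline{Y},\overline{d})$. A family $S=\{f_t:Y\to Y\}_{t\ge 0}$ is a one-parameter continuous semigroup if $f_{s+t}=f_t\circ f_s$ for all $s,t\ge 0$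 and $\lim_{t\to 0^+}f_t(y)=f_0(y)=y$ for every $y\in Y$. ''Without bounded orbits'' means that no orbit $\{f_t(y):t\ge 0\}$, $y\in Y$, is $d$-bounded. Bounded sets of $Y$ are $d$-bounded sets. *)

(* Defs.v *)
From mathcomp Require Import all_boot all_order all_algebra.
From mathcomp Require Import all_classical all_reals all_analysis.

Set Implicit Arguments.
Unset Strict Implicit.
Unset Printing Implicit Defensive.
Import Order.TTheory GRing.Theory Num.Theory.
Import numFieldNormedType.Exports.
Local Open Scope classical_set_scope.
Local Open Scope ring_scope.

Section metric_space.
Context {R : realType} (Y : metricType R).

(* As a curve, gamma is required to be continuous on [a, b]; its values
   outside [a, b] are irrelevant. *)
Definition quasi_geodesic (kappa : R) : Prop :=
  forall x y : Y, exists (a b : R) (gamma : R -> Y),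
    [/\ a <= b, gamma a = x, gamma b = y,
        {within `[a, b], continuous gamma}
      & forall t1 t2, t1 \in `[a, b] -> t2 \in `[a, b] ->
          `|t1 - t2| - kappa <= mdist (gamma t1) (gamma t2) /\
          mdist (gamma t1) (gamma t2) <= `|t1 - t2| + kappa].

Definition dbounded (A : set Y) : Prop :=
  exists M : R, forall x y, A x -> A y -> mdist x y <= M.

Definition nonexpansive (f : Y -> Y) : Prop :=
  forall x y, mdist (f x) (f y) <= mdist x y.

(* The semigroup is indexed by R, but only times t >= 0 matter. *)
Definition continuous_semigroup (f : R -> Y -> Y) : Prop :=
  (forall s t, 0 <= s -> 0 <= t -> f (s + t) = f t \o f s) /\
  (forall y, f 0 y = y /\ f t y @[t --> 0^'+] --> y).

Definition without_bounded_orbits (f : R -> Y -> Y) : Prop :=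
  forall y, ~ dbounded [set f t y | t in [set t | 0 <= t]].

End metric_space.

(* The inclusion of Y in its ambient space Ybar is a map i : Y -> Ybar, since
   the two spaces carry different metrics; subsets of Y are viewed in Ybar
   through their image under i. *)
Section ambient_space.
Context {R : realType} {Y Ybar : metricType R} (i : Y -> Ybar).

Definition boundary : set Ybar := ~` range i.

(* initial_topology i is Y with the topology induced by Ybar. *)
Definition axiom1' : Prop :=
  [/\ injective i, open (range i), dense (range i),
      forall A : set Y, open A <-> @open (initial_topology i) A
    & forall (w : Y) (x : nat -> Y) (xi : Ybar), boundary xi ->
        i (x n) @[n --> \oo] --> xi ->
        mdist (x n) w @[n --> \oo] --> +oo].

Definition axiom4' : Prop :=
  forall (x y : nat -> Y) (xi eta : Ybar), boundary xi -> boundary eta ->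
    i (x n) @[n --> \oo] --> xi -> i (y n) @[n --> \oo] --> eta ->
    (exists c : R, forall n, mdist (x n) (y n) <= c) ->
    xi = eta.

(* The traces on Y of the neighborhoods of zeta: w in Y tends to zeta. *)
Definition nbhs_trace (zeta : Ybar) : set_system Y :=
  [set i @^-1` V | V in nbhs zeta].

Definition big_horoball (z0 : Y) (zeta : Ybar) (r : R) : set Y :=
  [set y | (limf_einf (fun w => (mdist y w - mdist w z0)%:E)
              (nbhs_trace zeta) <= r%:E)%E].

Definition compact_map (f : Y -> Y) : Prop :=
  compact (closure (i @` range f)).

(* 0 is adjoined so that the supremum over the empty set is 0, not -oo. *)
Definition sup_dist (A : set Y) (xi : Ybar) : \bar R :=
  ereal_sup (0%E |` [set (mdist (i x) xi)%:E | x in A]).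

End ambient_space.

(* Main.v *)
(* Let g = f t0 and a_n = d(g^n z0, z0). Compactness of g makes bounded subsets
   of its range precompact, and an argument in the spirit of Calka's theorem
   turns the unboundedness of (a_n) into a_n -> +oo. Along a sequence of record
   times N_k of (a_n), the points w_k = g^{N_k} z0 converge to some xi in the
   boundary. Fix D and m. Since a_{N_k - m} <= a_{N_k}, the point y at distance
   about D from z0 on a quasi-geodesic to g^{N_k - m} z0 satisfies
     d(g^m y, w_k) - d(w_k, z0) <= -D + 2 kappa,
   while g^m y stays within D + kappa of g^m z0. By compactness a single y nearly
   works for infinitely many k, so g^m z0 is at distance at most D + kappa from
   a horoball at xi whose radius tends to -oo with D. By Axiom 4' every limit of
   the orbit of z0 then lies in the closures of all the horoballs at xi, i.e. is
   the single point p of their intersection. Finally f_t x stays, uniformly for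
   x in a bounded set, within bounded distance of g^m z0 for the integer m with
   m t0 <= t < (m + 1) t0, and Axiom 4' applies once more. The limit point is p;
   whether p = xi plays no role. *)
Require Import Defs.
From mathcomp Require Import all_boot all_order all_algebra.
From mathcomp Require Import all_classical all_reals all_analysis.
From mathcomp Require Import lra zify.
Set Implicit Arguments.
Unset Strict Implicit.
Unset Printing Implicit Defensive.
Import Order.TTheory GRing.Theory Num.Theory.
Import numFieldNormedType.Exports.
Local Open Scope classical_set_scope.
Local Open Scope ring_scope.

(** * Sequential criteria for limits and compactness *)

Section sequences_in_metric_spaces.
Context {R : realType} {V : metricType R}.

Lemma seq_cvgP (x : nat -> V) (l : V) :
  x n @[n --> \oo] --> l <->
  forall e : R, 0 < e -> exists N, forall n, (N <= n)%N -> mdist l (x n) < e.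
Proof.
split=> [/metricType_numDomainType.cvgrPdist_lt xl e e0|xl].
  by have [N _ HN] := xl e e0; exists N => n Nn; apply: HN.
apply/metricType_numDomainType.cvgrPdist_lt => e /xl[N HN].
by exists N => // n; apply: HN.
Qed.

Lemma cvg_subseq (x : nat -> V) (l : V) (s : nat -> nat) :
  (forall n, (n <= s n)%N) -> x n @[n --> \oo] --> l ->
  x (s n) @[n --> \oo] --> l.
Proof.
move=> sn /seq_cvgP xl; apply/seq_cvgP => e /xl[N HN].
by exists N => n Nn; apply: HN; apply: leq_trans (sn n).
Qed.

(** The selection [s] may fail to be monotone: [n <= s n] already preserves limits at infinity and
    is stable under composition. *)
Lemma compact_cvg_subseq (K : set V) (u : nat -> V) :
  compact K -> (forall n, K (u n)) ->
  exists (s : nat -> nat) (l : V),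
    (forall n, (n <= s n)%N) /\ u (s n) @[n --> \oo] --> l.
Proof.
move=> cK Ku.
have [l [_ cl]] : K `&` cluster (u n @[n --> \oo]) !=set0.
  by apply: cK; exists 0%N => // n _; apply: Ku.
have /choice[s Hs] n :
    exists k, (n <= k)%N /\ mdist l (u k) < n.+1%:R^-1 :> R.
  have [] := cl (u @` [set k | (n <= k)%N]) (ball l (n.+1%:R^-1 : R)).
  - by exists n => // k nk; exists k.
  - by apply: nbhsx_ballx; rewrite invr_gt0 ltr0n.
  by move=> _ [[k nk <-]]; rewrite ballEmdist /= => luk; exists k.
exists s, l; split; first by move=> n; case: (Hs n).
apply/seq_cvgP => e e0; exists (Num.truncn e^-1) => n en.
have [_ /lt_le_trans] := Hs n; apply.
rewrite -[leRHS]invrK lef_pV2 ?posrE ?invr_gt0 ?ltr0n//.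
by apply/ltW; rewrite -Num.Theory.truncn_le_nat.
Qed.

End sequences_in_metric_spaces.

Lemma seq_cvgryP {R : realType} (x : nat -> R) :
  x n @[n --> \oo] --> +oo <->
  forall M : R, exists N, forall n, (N <= n)%N -> M <= x n.
Proof.
split=> [/cvgryPge xl M|xl].
  by have [N _ HN] := xl M; exists N => n Nn; apply: HN.
by apply/cvgryPge => M; have [N HN] := xl M; exists N => // n; apply: HN.
Qed.

Lemma cvgry_subseq {R : realType} (x : nat -> R) (s : nat -> nat) :
  (forall n, (n <= s n)%N) -> x n @[n --> \oo] --> +oo ->
  x (s n) @[n --> \oo] --> +oo.
Proof.
move=> sn /seq_cvgryP xl; apply/seq_cvgryP => M; have [N HN] := xl M.
by exists N => n Nn; apply: HN; apply: leq_trans (sn n).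
Qed.

(** * A Calka-type dichotomy for orbits of a nonexpansive map *)

Section iteration.
Context {R : realType} {Y : metricType R} (g : Y -> Y).
Hypothesis g_nonexp : nonexpansive g.

Lemma iter_nonexp n : nonexpansive (iter n g).
Proof.
by elim: n => // n IH x y /=; apply: le_trans (g_nonexp _ _) (IH x y).
Qed.

(** Precompactness of the bounded parts of [range g], in a form that names no limit point. *)
Definition boundedly_precompact : Prop :=
  forall (u : nat -> Y) (w : Y) (M e : R), 0 < e ->
    (forall n, mdist (g (u n)) w <= M) ->
    exists s : nat -> nat, (forall n, (n <= s n)%N) /\
      forall n, mdist (g (u (s n))) (g (u (s 0%N))) <= e.

Hypothesis g_pre : boundedly_precompact.

                                                                             
                                                                              
                                                                         
                                   
(** Returns to the unit ball around [q] have bounded gaps: ever longer excursions would start at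
    points that accumulate, and a late return of [q], copied by nonexpansiveness to a nearby start,
    would cut one short. Taking [q] in the range of [g] makes [g_pre] apply to the whole orbit. *)
Lemma recurrent_orbit_bounded (p : Y) :
  let q := g p in
  (forall L, exists2 m, (L <= m)%N & mdist (iter m g q) q <= 2^-1) ->
  exists M : R, forall n, mdist (iter n g q) q <= M.
Proof.
move=> q rec.
have itq n : iter n g q = g (iter n g p) by rewrite /q -iterSr.
have [N gap] : exists N, forall n, mdist (iter n g q) q <= 1 ->
    exists n', [/\ (n < n')%N, (n' <= n + N)%N & mdist (iter n' g q) q <= 1].
  apply: contrapT => /forallNP nogap.
  have /choice[a Ha] N : exists n, mdist (iter n g q) q <= 1 /\
      forall n', (n < n')%N -> (n' <= n + N)%N -> ~ mdist (iter n' g q) q <= 1.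
    have /existsNP[n /not_implyP[n1 Hn]] := nogap N.
    by exists n; split=> // n' nn' n'N n'1; apply: Hn; exists n'.
  have [] := g_pre (u := fun N => iter (a N) g p) (w := q) (M := 1) (e := 2^-1).
  - lra.
  - by move=> n; rewrite -itq; case: (Ha n).
  move=> s [sn]; set a0 := a (s 0%N).
  move=> cl.
  (* Shifted by [m - a0] steps, this return is shadowed within 1/2 by the excursion starting at
     [a (s m)], too early for it since [m - a0 <= s m]. *)
  have [m am mq] := rec a0.+1.
  have [_ /(_ (a (s m) + (m - a0))%N)] := Ha (s m).
  have := sn m => msm; apply; [lia|lia|].
  have E1 : iter (a (s m) + (m - a0)) g q = iter (m - a0) g (iter (a (s m)) g q).
    by rewrite addnC iterD.
  have E2 : iter m g q = iter (m - a0) g (iter a0 g q).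
    by rewrite -iterD subnK// ltnW.
  have := metric_triangle (iter (a (s m) + (m - a0)) g q) (iter m g q) q.
  have := iter_nonexp (m - a0) (iter (a (s m)) g q) (iter a0 g q).
  rewrite -E1 -E2 => D1 D2.
  have := cl m; rewrite -!itq -/a0 => D3.
  lra.
(* With [k] a return at most [N] steps before [n], the 1 accounts for that return and the sum for
   the last [n - k] steps. *)
exists (1 + \sum_(j < N.+1) mdist (iter j g q) q) => n.
have [k [kn nkN k1]] : exists k, [/\ (k <= n)%N, (n <= k + N)%N &
    mdist (iter k g q) q <= 1].
  elim: n => [|n [k [kn nkN k1]]].
    by exists 0%N; split => //=; rewrite mdistxx.
  have [nN|nN] := ltnP n (k + N); first by exists k; split=> //; lia.
  have [n' [kn' n'N n'1]] := gap k k1.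
  by exists n'; split => //; lia.
have j0 : (n - k < N.+1)%N by lia.
rewrite (bigD1 (Ordinal j0))//=.
have : 0 <= \sum_(j < N.+1 | j != Ordinal j0) mdist (iter j g q) q.
  by apply: sumr_ge0 => j _; apply: mdist_ge0.
have := iter_nonexp (n - k) (iter k g q) q.
rewrite -iterD subnK//.
have := metric_triangle (iter n g q) (iter (n - k) g q) q.
lra.
Qed.

(** If infinitely many iterates stay bounded, [g_pre] makes one of them, [q], recurrent up to 1/2;
    its orbit is then bounded, and nonexpansiveness passes the bound on to [z]. *)
Lemma unbounded_orbit_escapes (z : Y) :
  (forall M : R, exists n, M < mdist (iter n g z) z) ->
  mdist (iter n g z) z @[n --> \oo] --> +oo.
Proof.
move=> unb; apply: contrapT => noesc.
have [M HM] : exists M : R, forall N, exists2 n, (N <= n)%N &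
    mdist (iter n g z) z <= M.
  apply: contrapT => /forallNP H; apply: noesc; apply/seq_cvgryP => M.
  have /existsNP[N HN] := H M; exists N => n Nn.
  by rewrite leNgt; apply/negP => nM; apply: HN; exists n => //; exact: ltW.
have /choice[a Ha] N : exists n, (N <= n)%N /\ mdist (iter n.+1 g z) z <= M.
  by have [[//|n] Nn nM] := HM N.+1; exists n.
have [] := g_pre (u := fun N => iter (a N) g z) (w := z) (M := M) (e := 2^-1).
- lra.
- by move=> n; case: (Ha n).
move=> s [sn]; set a0 := a (s 0%N) => cl.
pose q := iter a0.+1 g z.
have [|M' HM'] := @recurrent_orbit_bounded (iter a0 g z).
  move=> L; have [aN _] := Ha (s (L + a0)%N); have := sn (L + a0)%N.
  set k := a (s (L + a0)%N) in aN *.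
  move=> LN; exists (k - a0)%N; first by lia.
  have /= := cl (L + a0)%N.
  rewrite -/k -!iterS -iterD => H.
  by have -> : (k - a0 + a0.+1 = k.+1)%N by lia.
have [n] := unb (M' + mdist q z *+ 2).
have := iter_nonexp n z q; have := HM' n; rewrite -/q.
have := metric_triangle (iter n g z) (iter n g q) z.
have := metric_triangle (iter n g q) q z.
rewrite (metric_sym z q) mulr2n; lra.
Qed.

End iteration.

(** * Record times and points on quasi-geodesics *)

Lemma record_times {R : realType} (a : nat -> R) :
  a n @[n --> \oo] --> +oo ->
  exists N : nat -> nat, forall k, (k <= N k)%N /\
    forall m, (m <= N k)%N -> a m <= a (N k).
Proof.
move=> /seq_cvgryP ay.
suff /choice[N HN] k : exists N, (k <= N)%N /\ forall m, (m <= N)%N -> a m <= a N.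
  by exists N.
(* The first index where [a] reaches [M] is a record, and it is at least [k] because [M] exceeds the
   first [k] values. *)
pose M := 1 + \sum_(j < k) `|a j|.
have exM : exists n, M <= a n by have [n Hn] := ay M; exists n; apply: Hn.
case: (ex_minnP exM) => n Mn nmin; exists n; split.
  rewrite leqNgt; apply/negP => nk; move: Mn; rewrite /M (bigD1 (Ordinal nk))//=.
  have : 0 <= \sum_(j < k | j != Ordinal nk) `|a j| by apply: sumr_ge0.
  have := ler_norm (a n); lra.
move=> m; rewrite leq_eqVlt => /orP[/eqP->//|mn].
rewrite (le_trans _ Mn)// leNgt; apply/negP => /ltW /nmin; lia.
Qed.

(** The point at parameter [a + D] works: comparing [b - a] with [mdist x w] costs one [kappa],
    comparing [b - (a + D)] with [mdist y w] the other. *)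
Lemma quasi_geodesic_point {R : realType} (Y : metricType R) (kappa : R)
    (x w : Y) (D : R) :
  quasi_geodesic Y kappa -> 0 <= D -> D + kappa <= mdist x w ->
  exists y, mdist x y <= D + kappa /\ mdist y w <= mdist x w - D + kappa *+ 2.
Proof.
move=> qg D0; have [a [b [c [ab <- <- _ Hc]]]] := qg x w => Dxw.
have aI : a \in `[a, b] by rewrite in_itv /= lexx.
have bI : b \in `[a, b] by rewrite in_itv /= lexx ab.
have [ab1 ab2] := Hc _ _ aI bI.
rewrite distrC ger0_norm ?subr_ge0// in ab1 ab2.
have dI : a + D \in `[a, b].
  rewrite in_itv /= lerDl D0 /=; lra.
exists (c (a + D)); split.
- have [_] := Hc _ _ aI dI; rewrite opprD addNKr normrN ger0_norm//.
- have [_] := Hc _ _ dI bI; rewrite distrC ger0_norm ?mulr2n; first by lra.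
  by move: dI; rewrite in_itv /= => /andP[_]; rewrite subr_ge0.
Qed.

(** * Boundary limits and horoballs *)

Section ambient_space.
Context {R : realType} {Y Ybar : metricType R} (i : Y -> Ybar).

Lemma seq_cvg_closure (A : set Y) (x : nat -> Y) (l : Ybar) :
  (forall n, A (x n)) -> i (x n) @[n --> \oo] --> l -> closure (i @` A) l.
Proof.
move=> Ax xl B /xl[N _ /(_ N (leqnn N)) BN].
by exists (i (x N)); split=> //; exists (x N).
Qed.

(** Every neighborhood of [zeta] contains some [i (w n)], so each infimum under the supremum
    defining the lower limit is at most [r]. *)
Lemma big_horoball_seq (z0 : Y) (zeta : Ybar) (r : R) (w : nat -> Y) (y : Y) :
  i (w n) @[n --> \oo] --> zeta ->
  (forall n, mdist y (w n) - mdist (w n) z0 <= r) ->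
  big_horoball i z0 zeta r y.
Proof.
move=> wz yr; rewrite /big_horoball /= limf_einfE.
apply: ge_ereal_sup => _ [_ [V zV <-] <-].
have [N _ /(_ N (leqnn N)) VN] := wz _ zV.
apply: ereal_inf_le; exists (mdist y (w N) - mdist (w N) z0)%:E.
  by exists (w N).
by rewrite lee_fin.
Qed.

Lemma cvgry_near (w : Y) (c : R) (x y : nat -> Y) :
  (forall n, mdist (x n) (y n) <= c) ->
  mdist (x n) w @[n --> \oo] --> +oo -> mdist (y n) w @[n --> \oo] --> +oo.
Proof.
move=> xyc /seq_cvgryP xy; apply/seq_cvgryP => M; have [N HN] := xy (M + c).
exists N => n /HN; have := metric_triangle (x n) (y n) w; have := xyc n; lra.
Qed.

Hypothesis ax1 : axiom1' i.

Lemma cvg_in_range (x : nat -> Y) (y : Y) :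
  i (x n) @[n --> \oo] --> i y -> x n @[n --> \oo] --> y.
Proof.
have [_ _ _ topE _] := ax1 => xy A.
rewrite nbhsE => -[B [oB By] BA].
have [U oU UB] := (topE B).1 oB.
have /xy[N _ HN] : nbhs (i y) U.
  by apply: open_nbhs_nbhs; split=> //; rewrite -UB in By.
by exists N => // n /HN Un; apply: BA; rewrite -UB.
Qed.

(** A limit [i y] would make [x] converge to [y] in the metric of [Y], hence stay bounded. *)
Lemma escape_boundary (w : Y) (x : nat -> Y) (l : Ybar) :
  mdist (x n) w @[n --> \oo] --> +oo -> i (x n) @[n --> \oo] --> l ->
  boundary i l.
Proof.
move=> /seq_cvgryP xw xl [y _ yl]; rewrite -yl in xl.
have /seq_cvgP/(_ 1 ltr01)[N HN] := cvg_in_range xl.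
have [N' HN'] := xw (mdist y w + 1).
have := HN _ (leq_maxl N N'); have := HN' _ (leq_maxr N N').
have := metric_triangle (x (maxn N N')) y w; rewrite (metric_sym _ y); lra.
Qed.

Lemma compact_map_subseq (g : Y -> Y) (u : nat -> Y) :
  compact_map i g -> exists (s : nat -> nat) (l : Ybar),
    (forall n, (n <= s n)%N) /\ i (g (u (s n))) @[n --> \oo] --> l.
Proof.
move=> cg; apply: (compact_cvg_subseq (u := fun n => i (g (u n))) cg) => n.
by apply: subset_closure; exists (g (u n)) => //; exists (u n).
Qed.

(** By Axiom 1' a bounded sequence has no limit on the boundary, so the limit given by compactness
    comes from [Y], where convergence holds for the metric of [Y]. *)
Lemma compact_map_boundedly_precompact (g : Y -> Y) :
  compact_map i g -> boundedly_precompact g.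
Proof.
move=> cg u w M e e0 uM; have [s [l [sn sl]]] := compact_map_subseq u cg.
have [_ _ _ _ bd] := ax1.
have [y _ yl] : range i l.
  apply: contrapT => lb; have /seq_cvgryP/(_ (M + 1))[N HN] := bd w _ _ lb sl.
  have := HN N (leqnn N); have := uM (s N); lra.
rewrite -yl in sl.
have e20 : 0 < e / 2 by lra.
have /seq_cvgP/(_ _ e20)[N HN] := cvg_in_range sl.
(* The shift by [N] brings the reference term, of index 0, into the tail as well. *)
exists (fun n => s (n + N)%N); split=> [n|n].
  by apply: leq_trans (sn _); apply: leq_addr.
have := HN (n + N)%N (leq_addl _ _); have := HN (0 + N)%N (leq_addl _ _).
have := metric_triangle (g (u (s (n + N)%N))) y (g (u (s (0 + N)%N))).
rewrite (metric_sym _ y); lra.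
Qed.

Hypothesis ax4 : axiom4' i.

(** The center [xi] is fixed before the times [m], so all limits of the orbit are confined to the
    same horoballs. *)
Lemma orbit_limits_in_horoballs (kappa : R) (g : Y -> Y) (z0 : Y) :
  quasi_geodesic Y kappa -> nonexpansive g -> compact_map i g ->
  mdist (iter n g z0) z0 @[n --> \oo] --> +oo ->
  exists2 xi, boundary i xi & forall (m : nat -> nat) (eta : Ybar),
    (forall l, (l < m l)%N) -> i (iter (m l) g z0) @[l --> \oo] --> eta ->
    forall r, closure (i @` big_horoball i z0 xi r) eta.
Proof.
move=> qg gn cg esc; pose a n := mdist (iter n g z0) z0.
have [N HN] := record_times esc.
(* Record times of positive index are positive, so these iterates lie in the range of [g] and
   compactness applies. *)
have /choice[N' HN'] k : exists n, N k.+1 = n.+1.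
  by have [+ _] := HN k.+1; case: (N k.+1) => // n _; exists n.
have [s [xi [sn sxi]]] := compact_map_subseq (fun k => iter (N' k) g z0) cg.
pose T k := N (s k).+1.
have kT k : (k <= T k)%N.
  by have [+ _] := HN (s k).+1; have := sn k; rewrite /T; lia.
have aT k m : (m <= T k)%N -> a m <= a (T k).
  by have [_ H] := HN (s k).+1; apply: H.
have wxi : i (iter (T k) g z0) @[k --> \oo] --> xi.
  by rewrite (_ : (fun k => _) = (fun k => i (g (iter (N' (s k)) g z0))))//;
    apply/funext => k; rewrite /T HN'.
exists xi.
  by apply: escape_boundary wxi; apply: (cvgry_subseq (x := a)) esc.
(* The 1 in the radius is the tolerance at which precompactness replaces infinitely many points by a
   single one. *)
have shadow m D : (0 < m)%N -> 0 <= D -> exists y,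
    mdist (g y) (iter m g z0) <= D + kappa /\
    big_horoball i z0 xi (1 - D + kappa *+ 2) (g y).
  case: m => // m _ D0.
  have /seq_cvgryP/(_ (D + kappa + a m.+1))[K HK] := esc.
  pose T' k := T (k + (m.+1 + K))%N.
  have mT' k : (m.+1 <= T' k)%N.
    by apply: leq_trans (kT _); rewrite addnCA leq_addr.
  have /choice[y Hy] k : exists y, mdist z0 y <= D + kappa /\
      mdist y (iter (T' k - m.+1) g z0) <= a (T' k) - D + kappa *+ 2.
    (* The surplus [a m.+1] pays for going back [m.+1] steps: that iterate is still at distance at
       least [D + kappa] from [z0]. The record property next bounds this distance by [a (T' k)]. *)
    have : D + kappa + a m.+1 <= a (T' k).
      by apply: HK; apply: leq_trans (kT _); rewrite addnA leq_addl.
    have : a (T' k - m.+1)%N <= a (T' k) by apply: aT; apply: leq_subr.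
    have := iter_nonexp gn m.+1 (iter (T' k - m.+1) g z0) z0.
    have := metric_triangle (iter (T' k) g z0) (iter m.+1 g z0) z0.
    rewrite -iterD subnKC// /a (metric_sym _ z0).
    rewrite (metric_sym (iter (T' k - m.+1) g z0) z0) => H1 H2 H3 H4.
    have [|y [y1 y2]] := @quasi_geodesic_point _ _ kappa z0
      (iter (T' k - m.+1) g z0) D qg D0; first by lra.
    by exists y; split=> //; lra.
  have [|s' [s'n cl]] := compact_map_boundedly_precompact cg
    (u := fun k => iter m g (y k)) (w := iter m.+1 g z0) (M := D + kappa) ltr01.
    move=> k; apply: le_trans (iter_nonexp gn m.+1 (y k) z0) _.
    by rewrite metric_sym; case: (Hy k).
  exists (iter m g (y (s' 0%N))); split.
    apply: le_trans (iter_nonexp gn m.+1 (y (s' 0%N)) z0) _.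
    by rewrite metric_sym; case: (Hy (s' 0%N)).
  apply: (big_horoball_seq (w := fun k => iter (T' (s' k)) g z0)).
    apply: (cvg_subseq (x := fun k => i (iter (T k) g z0))
      (s := fun k => (s' k + (m.+1 + K))%N)) wxi => k.
    by apply: leq_trans (s'n k) _; apply: leq_addr.
  move=> k; have := cl k; have [_] := Hy (s' k).
  have := iter_nonexp gn m.+1 (y (s' k)) (iter (T' (s' k) - m.+1) g z0).
  rewrite -iterD subnKC// /=.
  have := metric_triangle (g (iter m g (y (s' 0%N))))
    (g (iter m g (y (s' k)))) (iter (T' (s' k)) g z0).
  rewrite (metric_sym (g (iter m g (y (s' 0%N)))) (g (iter m g (y (s' k))))).
  rewrite /a; lra.
move=> m eta lm meta r.
(* Then [1 - D + kappa *+ 2 <= r], and the absolute value keeps [D] nonnegative. *)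
pose D := `|1 + kappa *+ 2 - r|.
have /choice[y Hy] l :=
  shadow (m l) D (leq_ltn_trans (leq0n l) (lm l)) (normr_ge0 _).
have [s' [eta' [s'n yeta']]] := compact_map_subseq y cg.
have mesc : mdist (iter (m (s' l)) g z0) z0 @[l --> \oo] --> +oo.
  apply: (cvgry_subseq (x := a) (s := fun l => m (s' l))) esc => l.
  by apply: leq_trans (s'n l) _; apply: ltnW.
have meta' : i (iter (m (s' l)) g z0) @[l --> \oo] --> eta.
  by apply: (cvg_subseq (x := fun l => i (iter (m l) g z0))) meta.
have bnd l : mdist (iter (m (s' l)) g z0) (g (y (s' l))) <= D + kappa.
  by rewrite metric_sym; case: (Hy (s' l)).
have -> : eta = eta'.
  apply: (ax4 _ _ meta' yeta'); last by exists (D + kappa).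
  - exact: escape_boundary mesc meta'.
  - exact: escape_boundary (cvgry_near bnd mesc) yeta'.
apply: seq_cvg_closure yeta' => l; have [_] := Hy (s' l).
rewrite /big_horoball /= => /le_trans; apply; rewrite lee_fin.
have := ler_norm (1 + kappa *+ 2 - r); rewrite -/D; lra.
Qed.

End ambient_space.

(** * Continuous time against iterates of a single map *)

Lemma time_split {R : realType} (t0 t : R) :
  0 < t0 -> 0 <= t ->
  exists (m : nat) (s : R), [/\ t = s + m%:R * t0, 0 <= s & s <= t0].
Proof.
move=> t00 t_ge0; exists (Num.truncn (t / t0)), (t - (Num.truncn (t / t0))%:R * t0).
have /andP[h1 h2] := Num.Theory.truncn_itv (divr_ge0 t_ge0 (ltW t00)).
rewrite ler_pdivlMr// in h1; rewrite ltr_pdivrMr// -natr1 mulrDl mul1r in h2.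
by split; lra.
Qed.

Section semigroup.
Context {R : realType} {Y : metricType R} (f : R -> Y -> Y).
Hypothesis f_semigroup : continuous_semigroup f.
Hypothesis f_nonexp : forall t, 0 <= t -> nonexpansive (f t).

Lemma semigroup_iter (t0 : R) (n : nat) (y : Y) :
  0 <= t0 -> f (n%:R * t0) y = iter n (f t0) y.
Proof.
move=> t00; have [fD f0] := f_semigroup.
elim: n => [|n IH]; first by rewrite mul0r; have [] := f0 y.
by rewrite -natr1 mulrDl mul1r fD ?mulr_ge0//= IH.
Qed.

Lemma semigroup_split (t0 s : R) (m : nat) (y : Y) :
  0 <= t0 -> 0 <= s -> f (s + m%:R * t0) y = iter m (f t0) (f s y).
Proof.
move=> t00 s0; have [fD _] := f_semigroup.
by rewrite fD ?mulr_ge0//= semigroup_iter.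
Qed.

(** Continuity at time 0 bounds the displacement of [y] by 1 up to time [d / 2]; by nonexpansiveness
    each further step of that length adds at most 1. *)
Lemma semigroup_locally_bounded (y : Y) (T : R) :
  exists B, forall s, 0 <= s -> s <= T -> mdist (f s y) y <= B.
Proof.
have [_ f0] := f_semigroup; have [f0y fy] := f0 y.
have := metricType_numDomainType.cvgr_dist_lt fy ltr01.
case=> d /= d0 Hd.
have near0 s : 0 <= s -> s <= d / 2 -> mdist (f s y) y <= 1.
  rewrite le_eqVlt => /orP[/eqP<- _|s0 sd]; first by rewrite f0y mdistxx.
  rewrite metric_sym; apply/ltW/Hd => //=.
  by rewrite sub0r normrN gtr0_norm//; lra.
exists (1 + (Num.truncn (T / (d / 2)))%:R) => s s0 sT.
have d20 : 0 < d / 2 by lra.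
have [m [r [sE r0 rd]]] := time_split d20 s0.
have step k : mdist (iter k (f (d / 2)) y) y <= k%:R.
  elim: k => [|k IH]; first by rewrite mdistxx.
  have := metric_triangle (iter k.+1 (f (d / 2)) y) (f (d / 2) y) y.
  have := f_nonexp (ltW d20) (iter k (f (d / 2)) y) y.
  have := near0 _ (ltW d20) (lexx _).
  rewrite /= -natr1; lra.
have mT : m%:R <= (Num.truncn (T / (d / 2)))%:R :> R.
  rewrite ler_nat Num.Theory.truncn_ge_nat.
    by rewrite ler_pdivlMr//; lra.
  by apply: divr_ge0; [exact: le_trans s0 sT|exact: ltW].
have := metric_triangle (f s y) (iter m (f (d / 2)) y) y.
have := near0 _ r0 rd; have := step m.
have := @iter_nonexp _ _ _ (f_nonexp (ltW d20)) m (f r y) y.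
rewrite -semigroup_split -?sE//; [lra|exact: ltW].
Qed.

(** Remainders of time in [0, [t0]] shift the iterates by a bounded amount, so bounded iterates
    would bound the whole orbit. *)
Lemma semigroup_unbounded_iter (t0 : R) (z : Y) :
  0 < t0 -> without_bounded_orbits f ->
  forall M : R, exists n, M < mdist (iter n (f t0) z) z.
Proof.
move=> t00 unb M; apply: contrapT => /forallNP bnd; apply: (unb z).
have [B HB] := semigroup_locally_bounded z t0.
have zB t : 0 <= t -> mdist (f t z) z <= B + M.
  move=> t_ge0; have [m [s [-> s0 st0]]] := time_split t00 t_ge0.
  rewrite semigroup_split ?(ltW t00)//.
  have := metric_triangle (iter m (f t0) (f s z)) (iter m (f t0) z) z.
  have := @iter_nonexp _ _ _ (f_nonexp (ltW t00)) m (f s z) z.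
  have := HB s s0 st0; have := bnd m => /negP; rewrite -leNgt; lra.
exists ((B + M) *+ 2) => _ _ [t t_ge0 <-] [t' t'_ge0 <-].
have := metric_triangle (f t z) z (f t' z); rewrite (metric_sym z).
by have := zB _ t_ge0; have := zB _ t'_ge0; rewrite mulr2n; lra.
Qed.

End semigroup.

(** * Uniform convergence on bounded sets *)

Lemma sup_dist_cvg0 (R : realType) (Y Ybar : metricType R) (i : Y -> Ybar)
    (xi : Ybar) (A : R -> set Y) :
  (forall e : R, 0 < e -> exists T : R, forall t x, T <= t -> A t x ->
    mdist (i x) xi <= e) ->
  sup_dist i (A t) xi @[t --> +oo] --> 0%E.
Proof.
move=> H.
have near_bnd e : 0 < e -> \forall t \near +oo,
    (0 <= sup_dist i (A t) xi <= e%:E)%E.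
  move=> e0; have [T HT] := H e e0.
  near=> t; apply/andP; split.
    by apply: ereal_sup_ubound; left.
  apply: ge_ereal_sup => _ [->|[x Ax <-]]; rewrite lee_fin ?(ltW e0)//.
  apply: HT Ax; near: t; exact: nbhs_pinfty_ge (num_real T).
apply/fine_cvgP; split.
  near=> t; have /andP[] : (0 <= sup_dist i (A t) xi <= 1%:E)%E.
    by near: t; exact: near_bnd.
  by case: (sup_dist i (A t) xi).
apply/cvgrPdist_le => e e0; near=> t.
have /andP[] : (0 <= sup_dist i (A t) xi <= e%:E)%E.
  by near: t; exact: near_bnd.
rewrite /=; case: (sup_dist i (A t) xi) => //= r; rewrite !lee_fin => r0 re.
by rewrite sub0r normrN ger0_norm.
Unshelve. all: by end_near. Qed.

Theorem theorem3p4 (R : realType) (Y Ybar : metricType R) (i : Y -> Ybar)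
    (kappa : R) (f : R -> Y -> Y) :
  [set: Y] !=set0 ->
  0 <= kappa -> quasi_geodesic Y kappa ->
  axiom1' i -> axiom4' i ->
  (forall (zeta : Ybar) (z0 : Y), boundary i zeta ->
     exists p : Ybar,
       \bigcap_(r in [set: R]) closure (i @` big_horoball i z0 zeta r)
         = [set p]) ->
  continuous_semigroup f ->
  (forall t, 0 <= t -> nonexpansive (f t)) ->
  without_bounded_orbits f ->
  (exists t0 : R, 0 < t0 /\ compact_map i (f t0)) ->
  exists xi : Ybar, boundary i xi /\
    forall C : set Y, dbounded C ->
      sup_dist i (f t @` C) xi @[t --> +oo] --> 0%E.
Proof.
move=> [z0 _] _ qg ax1 ax4 horo sg ne unb [t0 [t00 cg]].
pose g := f t0; have gn : nonexpansive g := ne _ (ltW t00).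
have esc : mdist (iter n g z0) z0 @[n --> \oo] --> +oo.
  apply: unbounded_orbit_escapes => //.
    exact: (compact_map_boundedly_precompact ax1 cg).
  exact: semigroup_unbounded_iter.
have escs (m : nat -> nat) : (forall l, (l < m l)%N) ->
    mdist (iter (m l) g z0) z0 @[l --> \oo] --> +oo.
  by move=> lm; apply: (cvgry_subseq _ esc) => l; exact: ltnW.
have [xi bxi xiP] := orbit_limits_in_horoballs ax1 ax4 qg gn cg esc.
have [p capp] := horo xi z0 bxi.
have limp (m : nat -> nat) eta : (forall l, (l < m l)%N) ->
    i (iter (m l) g z0) @[l --> \oo] --> eta -> eta = p.
  move=> lm meta.
  by have : [set p] eta by rewrite -capp => r _; apply: xiP meta _.
exists p; split.
  (* [p] is itself a limit of escaping iterates, hence a boundary point. *)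
  have [s [eta [sn seta]]] := compact_map_subseq (fun n => iter n g z0) cg.
  have lm l : (l < (s l).+1)%N by rewrite ltnS.
  by rewrite -(limp _ _ lm seta); apply: escape_boundary (escs _ lm) seta.
move=> C [M CM]; apply: sup_dist_cvg0 => e e0; apply: contrapT => /forallNP far.
have [B HB] := semigroup_locally_bounded sg ne z0 t0.
have /choice[x Hx] l : exists x : nat * R * Y,
    [/\ (l < x.1.1)%N, mdist (f x.1.2 z0) z0 <= B, 0 <= x.1.2, C x.2 &
      e < mdist (i (iter x.1.1 g (f x.1.2 x.2))) p].
  (* The [l.+2] absorbs the remainder [s <= t0]: the number [m] of full steps still exceeds [l]. *)
  have /existsNP[t /existsNP[_ /not_implyP[tl /not_implyP[[x Cx <-]]]]] :=
    far (l.+2%:R * t0).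
  have t_ge0 : 0 <= t by apply: le_trans tl; rewrite mulr_ge0// ltW.
  have [m [s [tE s0 st0]]] := time_split t00 t_ge0.
  move/negP; rewrite -ltNge tE semigroup_split// ?(ltW t00)// => far_p.
  exists (m, s, x); split=> //=; last exact: HB.
  rewrite -ltnS -(ltr_nat R) -(ltr_pM2r t00).
  rewrite -natr1 mulrDl mul1r in tl.
  rewrite -!natr1 !mulrDl !mul1r; rewrite tE -natr1 in tl; lra.
pose m l := (x l).1.1; pose y l := f (x l).1.2 (x l).2.
have lm l : (l < m l)%N by case: (Hx l).
have mE l : m l = (m l).-1.+1 by rewrite prednK// (leq_ltn_trans (leq0n l)).
have iterE z l : iter (m l) g z = g (iter (m l).-1 g z) by rewrite mE.
(* [B] covers the motion of [z0] during the remainder, [M] the size of [C], and [(x 0%N).2] serves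
   as base point of [C]. *)
have bnd l : mdist (iter (m l) g z0) (iter (m l) g (y l)) <=
    B + M + mdist (x 0%N).2 z0.
  apply: le_trans (iter_nonexp gn _ _ _) _.
  have [_ fB s0 Cl _] := Hx l; have [_ _ _ C0 _] := Hx 0%N.
  have := metric_triangle (y l) (f (x l).1.2 z0) z0.
  have := ne _ s0 (x l).2 z0; have := CM _ _ Cl C0.
  have := metric_triangle (x l).2 (x 0%N).2 z0.
  rewrite (metric_sym z0) -/(y l); lra.
have [s [eta [sn seta]]] :=
  compact_map_subseq (fun l => iter (m l).-1 g (y l)) cg.
have [s' [eta' [s'n seta']]] :=
  compact_map_subseq (fun l => iter (m (s l)).-1 g z0) cg.
pose k l := s (s' l).
have kl l : (l <= k l)%N by apply: leq_trans (s'n l) (sn _).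
have lmk l : (l < m (k l))%N by apply: leq_ltn_trans (lm _).
have yk : i (iter (m (k l)) g (y (k l))) @[l --> \oo] --> eta.
  under eq_fun do rewrite iterE.
  exact: (cvg_subseq (x := fun l => i (g (iter (m (s l)).-1 g (y (s l)))))) seta.
have zk : i (iter (m (k l)) g z0) @[l --> \oo] --> eta'.
  by under eq_fun do rewrite iterE.
(* Along [k] the iterates of [z0] tend to [p], so Axiom 4' forces the points kept [e]-far from [p]
   to tend to [p] as well. *)
have etap : eta = p.
  rewrite -(limp _ _ lmk zk); apply/esym; apply: (ax4 _ _ _ _ _ _ zk yk).
  - exact: escape_boundary (escs _ lmk) zk.
  - apply: escape_boundary ax1 _ _ _ (cvgry_near _ (escs _ lmk)) yk => l.
    exact: bnd.
  - by eexists => l; apply: bnd.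
have /seq_cvgP/(_ e e0)[N /(_ N (leqnn N))] := yk.
have [_ _ _ _] := Hx (k N); rewrite -/(m (k N)) -/(y (k N)) etap metric_sym.
lra.
Qed.
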